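(* Let $G_A$ have Lie algebra $\mathfrak g_A=\mathbb Re_0\ltimes_A\mathbb R^5$. If $A$ has one of the following forms, then $G_A$ admits no left-invariant generalized complex structure (of any type): (a) $J_5(\lambda)$, with $\lambda\ne0$; (b) $J_4(\lambda)\oplus\mu$, with $\lambda\ne0$; (c) $J_3(\lambda)\oplus J_2(\mu)$, with $\lambda\ne\pm\mu$. In particular, none of these groups admits a left-invariant generalized Calabi–Yau structure.
   Context: $\mathfrak g_A=\mathbb Re_0\ltimes_A\mathbb R^5$ is the real Lie algebra with abelian ideal $\mathfrak h=\mathbb R^5$ and bracket $[e_0,v]=Av$; $G_A$ is the simply connected Lie group with Lie algebra $\mathfrak g_A$. $J_r(t)$ is the $r\times r$ Jordan block with real eigenvalue $t$ and ones on the superdiagonal; a scalar summand is a $1\times1$ block; $\lambda,\mu\in\mathbb R$. Left-invariant generalized complex structures: for a Lie group $G$ with Lie algebra $\mathfrak g$ of real dimension $2n$ (here $n=3$), give $\mathfrak g\oplus\mathfrak g^*$ the pairing $\langle X+\xi,Y+\eta\rangle=\frac12(\xi(Y)+\eta(X))$. A left-invariant generalized complex structure on $G$ is (equivalently) a linear map $\mathcal J$ of $\mathfrak g\oplus\mathfrak g^*$ with $\mathcal J^2=-\mathrm{Id}$, orthogonal for the pairing, whose $\mathbf i$-eigenspace $L\subset(\mathfrak g\oplus\mathfrak g^* )\otimes\mathbb C$ is closed under the Courant bracket on left-invariant sections, $[[X+\xi,Y+\eta]]=[X,Y]+\mathrm{ad}^*_X\eta-\mathrm{ad}^*_Y\xi$,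 with $(\mathrm{ad}^*_X\eta)(Y)=-\eta([X,Y])$ (extended $\mathbb C$-bilinearly). The space $L$ is the annihilator, for the Clifford action $(X+\xi)\cdot\rho=\iota_X\rho+\xi\wedge\rho$, of a unique complex line $K_L\subset\bigwedge^\bullet\mathfrak g^*\otimes\mathbb C$. Any generator $\rho$ of $K_L$ has the form $\rho=\exp(B+\mathbf i\omega)\wedge\Omega$ with $B,\omega\in\bigwedge^2\mathfrak g^*$ real and $\Omega=\theta_1\wedge\cdots\wedge\theta_k$ with linearly independent $\theta_i\in\mathfrak g^*\otimes\mathbb C$ ($\Omega$ a nonzero constant if $k=0$), and satisfies $\omega^{n-k}\wedge\Omega\wedge\overline\Omega\ne0$; $k\in\{0,\dots,n\}$ is the type. A left-invariant generalized Calabi–Yau structure is a left-invariant generalized complex structure with a generator $\rho$ satisfying $\mathrm d\rho=0$, where $\mathrm d\xi(X,Y)=-\xi([X,Y])$ on $\mathfrak g^*$. *)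

(* Defs.v *)
From HB Require Import structures.
From mathcomp Require Import all_boot all_order all_algebra.
From mathcomp Require Import complex.
From mathcomp Require Import reals.

Set Implicit Arguments.
Unset Strict Implicit.
Unset Printing Implicit Defensive.

Import Order.TTheory GRing.Theory Num.Theory.
Local Open Scope ring_scope.

(* r x r, eigenvalue t, ones on the superdiagonal. *)
Definition jordan_block (F : nzRingType) (r : nat) (t : F) : 'M[F]_r :=
  \matrix_(i < r, j < r) (t *+ (i == j :> nat) + (j == i.+1 :> nat)%:R).

Definition dsum_mx (F : nzRingType) (p q : nat) (A : 'M[F]_p) (B : 'M[F]_q) :
  'M[F]_(p + q) := block_mx A 0 0 B.

(* R e_0 |x_A R^m on column vectors: coordinate 0 is the e_0-component and the
   other m coordinates are the component in the abelian ideal R^m. *)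
Definition semidirect_bracket (F : comNzRingType) (m : nat) (A : 'M[F]_m)
    (x y : 'cV[F]_(1 + m)) : 'cV[F]_(1 + m) :=
  col_mx 0 (usubmx x 0 0 *: (A *m dsubmx y) - usubmx y 0 0 *: (A *m dsubmx x)).

(* Vectors of g and covectors of g^* are both columns of coordinates, the
   latter in the dual basis; an element X + xi of g (+) g^* is col_mx X xi. *)
Section Coordinates.
Variables (F : fieldType) (n : nat).
Implicit Types (X Y xi eta : 'cV[F]_n) (u v : 'cV[F]_(n + n)).

Definition ev xi X : F := (xi^T *m X) 0 0.

Definition pairing u v : F :=
  2^-1 * (ev (dsubmx u) (usubmx v) + ev (dsubmx v) (usubmx u)).

Variable br : 'cV[F]_n -> 'cV[F]_n -> 'cV[F]_n.

(* (ad^*_X eta)(Y) = - eta([X, Y]), evaluated on the standard basis. *)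
Definition coad X eta : 'cV[F]_n :=
  \col_j - ev eta (br X (delta_mx j 0)).

Definition courant u v : 'cV[F]_(n + n) :=
  col_mx (br (usubmx u) (usubmx v))
         (coad (usubmx u) (dsubmx v) - coad (usubmx v) (dsubmx u)).

(* Elements of the exterior algebra of g^* are families of alternating
   multilinear k-forms, k = 0, 1, 2, ...; the arguments of a k-form are the k
   columns of an n x k matrix.  (Forms of degree k > n vanish.) *)
Definition mform := forall k : nat, 'M[F]_(n, k) -> F.

Definition multilinear k (f : 'M[F]_(n, k) -> F) : Prop :=
  forall (j : 'I_k) (a : F) (M N P : 'M[F]_(n, k)),
    (forall l, l != j -> col l M = col l N /\ col l M = col l P) ->
    col j M = a *: col j N + col j P -> f M = a * f N + f P.

Definition alternate k (f : 'M[F]_(n, k) -> F) : Prop :=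
  forall (M : 'M[F]_(n, k)) (i j : 'I_k),
    i != j -> col i M = col j M -> f M = 0.

Definition is_form (rho : mform) : Prop :=
  forall k, multilinear (rho k) /\ alternate (rho k).

Definition form_zero (rho : mform) : Prop := forall k M, rho k M = 0.

Definition interior X (rho : mform) : mform :=
  fun k M => rho k.+1 (row_mx X M).

Definition wedge1 xi (rho : mform) : mform := fun k =>
  match k return 'M[F]_(n, k) -> F with
  | 0 => fun=> 0
  | k'.+1 => fun M =>
      \sum_(i < k'.+1) (-1) ^+ i * ev xi (col i M) * rho k' (col' i M)
  end.

Definition clifford u (rho : mform) : mform := fun k M =>
  interior (usubmx u) rho M + wedge1 (dsubmx u) rho M.

(* Chevalley-Eilenberg differential, the derivation extending
   d xi (X, Y) = - xi([X, Y]):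
     d rho (X_0, ..., X_k) = sum_(i < j) (-1)^(i+j)
                 rho ([X_i, X_j], X_0, .. ^X_i .. ^X_j .., X_k).
   For i < j, column i of col' j M is X_i. *)
Definition dform (rho : mform) : mform := fun k =>
  match k return 'M[F]_(n, k) -> F with
  | k'.+2 => fun M =>
      \sum_(j < k'.+2) \sum_(i < k'.+1 | (i < j)%N)
        (-1) ^+ (i + j) *
        rho k'.+1 (row_mx (br (col i (col' j M)) (col j M)) (col' i (col' j M)))
  | _ => fun=> 0
  end.

End Coordinates.

Section GeneralizedComplex.
Variables (R : realType) (n : nat).
Local Notation C := R[i].
Implicit Types (J : 'M[R]_(n + n)).

Definition Remx (m : nat) (X : 'cV[C]_m) : 'cV[R]_m := map_mx (@complex.Re R) X.
Definition Immx (m : nat) (X : 'cV[C]_m) : 'cV[R]_m := map_mx (@complex.Im R) X.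
Definition toC (m p : nat) (X : 'M[R]_(m, p)) : 'M[C]_(m, p) :=
  map_mx (real_complex R) X.

Variable br : 'cV[R]_n -> 'cV[R]_n -> 'cV[R]_n.

Definition complexify (X Y : 'cV[C]_n) : 'cV[C]_n :=
  toC (br (Remx X) (Remx Y) - br (Immx X) (Immx Y)) +
  'i%C *: toC (br (Remx X) (Immx Y) + br (Immx X) (Remx Y)).

Definition eigenL J (u : 'cV[C]_(n + n)) : Prop :=
  toC J *m u = 'i%C *: u.

Definition gen_complex J : Prop :=
  [/\ J *m J = - 1%:M,
      forall u v : 'cV[R]_(n + n), pairing (J *m u) (J *m v) = pairing u v
    & forall u v, eigenL J u -> eigenL J v ->
        eigenL J (courant complexify u v)].

(* rho spans the line K_L whose annihilator is L. *)
Definition generator J (rho : mform C n) : Prop :=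
  [/\ is_form rho, ~ form_zero rho
    & forall u, eigenL J u <-> form_zero (clifford u rho)].

Definition gen_calabi_yau J : Prop :=
  gen_complex J /\
  exists rho, generator J rho /\ form_zero (dform complexify rho).

End GeneralizedComplex.

(* Main.v *)
Require Import Defs.
From HB Require Import structures.
From mathcomp Require Import all_boot all_order all_algebra.
From mathcomp Require Import complex.
From mathcomp Require Import reals.
From mathcomp Require Import ring lra zify.
Import Order.TTheory GRing.Theory Num.Theory.
Local Open Scope ring_scope.

(** Write [D = g (+) g^*], [b] for twice its pairing, [Z] for the covector dual
to [e_0], and [E] for the operator [0 (+) A (+) 0 (+) -A^T] on [D], that is,
[ad e_0].  The Courant bracket becomes
[[x, y] = b(Z, x) E y - b(Z, y) E x + b(E x, y) Z], with [E] skew for [b],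
[E Z = 0] and [b(Z, Z) = 0]: [D] is the double extension of the abelian algebra
[R^5 (+) (R^5)^*] by [E] (lemma [courant_semidirect]).  A generalized complex
structure is an orthogonal complex structure [J] on [D] whose Nijenhuis tensor
vanishes (lemma [integrable_real]).

Since [Z] is central, the vanishing of the Nijenhuis tensor at [(Z, y)] forces
[E (J Z)] into the plane [P = <Z, J Z>]: so [P] is isotropic and invariant
under [J] and [E], and both operators act on [W = P^perp / P].  Its vanishing
at [(e_0, x)] with [x] in [P^perp] then forces [E] and [J] to commute on [W]
(lemma [in_plane_commutator]).  Consequently no product of operators
[E - c] with [c] real has rank one on [W]: its image would be a real line
stable under a complex structure (lemma [no_rank_one]).

On the other hand, [E] has a Jordan block of size [r >= 2], for an eigenvalue
[lam <> 0], that a product [T] of operators [E - c] cuts down to a block of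
size two: [T] has image [<u, u'>] with [E u = lam u] and [E u' = lam u' + u],
so that [T (E - lam)] has rank one on [D].  Passing to [W] divides out at most
one eigenvector of [E] in [R^5 (+) (R^5)^*] and restricts to the orthogonal of
that vector, which shortens the block by at most one because [lam <> - lam].
Hence either [T (E - lam)] or [T] has rank one on [W], a contradiction (lemma
[no_isolated_jordan_pair]).

It remains to list the scalars [c].  For each of the three forms of [A] one
picks a block [J_r(lam)] of [A] with [lam <> 0], takes [lam] with multiplicity
[r - 2], and adds enough other scalars to kill the other blocks of [A], the
operator [-A^T], and the lines of [e_0] and [Z].  A generalized Calabi-Yau
structure is in particular a generalized complex structure. *)

(** * Products of shifted operators *)

(** The product of the commuting operators [f - c], [c] in [cs], applied to
[x]: a polynomial in [f] with its roots given as a list, so that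
multiplicities of roots are counts in that list. *)
Definition shifts {R : pzRingType} {V : lmodType R} (f : V -> V) (cs : seq R)
    (x : V) : V :=
  foldr (fun c y => f y - c *: y) x cs.

Lemma linear_shifts {R : comPzRingType} {V : lmodType R} (f : {linear V -> V})
    (cs : seq R) : linear (shifts f cs).
Proof.
elim: cs => [|c cs IH] a x y //=.
rewrite IH linearP !scalerDr scalerN opprD addrACA.
by congr (_ - _ + _); rewrite !scalerA mulrC.
Qed.

Lemma shifts_comm {R : comPzRingType} {V : lmodType R} (f : {linear V -> V})
    (cs : seq R) (x : V) : shifts f cs (f x) = f (shifts f cs x).
Proof. by elim: cs => [|c cs IH] //=; rewrite IH (linearB f) (linearZ_LR f). Qed.

(** * Orthogonal complex structures on a double extension *)

(** The bracket of the double extension of an abelian metric Lie algebra by the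
skew operator [E], with [Z] spanning the central isotropic line. *)
Definition dext_bracket {F : pzRingType} {V : lmodType F} (b : V -> V -> F)
    (E : V -> V) (Z : V) (x y : V) : V :=
  b Z x *: E y - b Z y *: E x + b (E x) y *: Z.

Section DoubleExtension.

Variables (R : realFieldType) (V : lmodType R) (b : V -> V -> R).
Variables (E J : {linear V -> V}) (Z e : V).

Hypothesis b_scalar : forall y, scalar (b^~ y).
Hypothesis bC : forall x y, b x y = b y x.
Hypothesis b_nondeg : forall x, (forall y, b x y = 0) -> x = 0.
Hypothesis b_skew : forall x y, b (E x) y = - b x (E y).
Hypotheses (EZ : E Z = 0) (bZZ : b Z Z = 0) (bZe : b Z e = 1).
Hypothesis J2 : forall x, J (J x) = - x.
Hypothesis bJJ : forall x y, b (J x) (J y) = b x y.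

Local Notation br := (dext_bracket b E Z).

Hypothesis J_integrable :
  forall x y, J (br x y - br (J x) (J y)) = br (J x) y + br x (J y).

Let bDl x y z : b (x + y) z = b x z + b y z.
Proof. by rewrite -{1}[x]scale1r b_scalar mul1r. Qed.
Let b0l z : b 0 z = 0.
Proof. by apply: (addrI (b 0 z)); rewrite -bDl !addr0. Qed.
Let bZl a x z : b (a *: x) z = a * b x z.
Proof. by rewrite -[a *: x]addr0 b_scalar b0l addr0. Qed.
Let bNl x z : b (- x) z = - b x z.
Proof. by rewrite -scaleN1r bZl mulN1r. Qed.
Let bDr x y z : b z (x + y) = b z x + b z y.
Proof. by rewrite ![b z _]bC bDl. Qed.
Let bZr a x z : b z (a *: x) = a * b z x.
Proof. by rewrite ![b z _]bC bZl. Qed.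
Let bNr x z : b z (- x) = - b z x.
Proof. by rewrite ![b z _]bC bNl. Qed.
Let b0r z : b z 0 = 0.
Proof. by rewrite bC b0l. Qed.
Let bE := (bDl, bDr, bNl, bNr, bZl, bZr, b0l, b0r).

(** Nondegeneracy turns identities between vectors into identities between
scalars, which are then within reach of [ring], [field] and [lra]. *)
Lemma b_inj x y : (forall z, b x z = b y z) -> x = y.
Proof.
move=> bxy; apply/eqP; rewrite -subr_eq0; apply/eqP/b_nondeg => z.
by rewrite !bE bxy subrr.
Qed.

Lemma bJ x y : b x (J y) = - b (J x) y.
Proof. by rewrite -(bJJ x) J2 !bE. Qed.

Lemma bxJx x : b x (J x) = 0.
Proof.
have h : b x (J x) = - b x (J x) by rewrite {1}bJ [b (J x) x]bC.
lra.
Qed.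

Local Notation w := (J Z).
(** The plane [P] and its orthogonal.  The quotient [P^perp / P] is not formed:
statements about it are congruences modulo [in_plane] between vectors of
[perp_plane]. *)
Definition in_plane (x : V) : Prop := exists a c : R, x = a *: Z + c *: w.
Definition perp_plane (x : V) : Prop := b Z x = 0 /\ b w x = 0.

Lemma in_plane_lin a x y : in_plane x -> in_plane y -> in_plane (a *: x + y).
Proof.
move=> [k [l ->]] [m [n ->]]; exists (a * k + m), (a * l + n).
by apply: b_inj => z; rewrite !bE; ring.
Qed.
Lemma in_plane0 : in_plane 0.
Proof. by exists 0, 0; rewrite !scale0r addr0. Qed.
Lemma in_planeZ a x : in_plane x -> in_plane (a *: x).
Proof.
by move=> Px; rewrite -[_ *: _]addr0; apply: in_plane_lin => //; apply: in_plane0.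
Qed.
Lemma in_planeD x y : in_plane x -> in_plane y -> in_plane (x + y).
Proof. by move=> Px; rewrite -[x]scale1r; apply: in_plane_lin. Qed.
Lemma in_planeB x y : in_plane x -> in_plane y -> in_plane (x - y).
Proof. by move=> Px Py; rewrite -scaleN1r addrC; apply: in_plane_lin. Qed.

Lemma in_plane_J x : in_plane x -> in_plane (J x).
Proof.
move=> [a [c ->]]; exists (- c), a.
rewrite (linearP J) (linearZ_LR J) J2.
by apply: b_inj => z; rewrite !bE; ring.
Qed.

Lemma perp_plane_J x : perp_plane x -> perp_plane (J x).
Proof. by move=> [h1 h2]; split; rewrite ?bJJ // bJ h2 oppr0. Qed.

(** The plane is [J]-stable, and [a + c J] is invertible with inverse
[(a - c J) / (a^2 + c^2)]: this is where [J] having no real eigenvalue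
enters. *)
Lemma in_plane_resolvent a c x :
  0 < a ^+ 2 + c ^+ 2 -> in_plane (a *: x + c *: J x) -> in_plane x.
Proof.
move=> ac0 h; have := in_planeB _ _ (in_planeZ a _ h) (in_planeZ c _ (in_plane_J _ h)).
move/(in_planeZ (a ^+ 2 + c ^+ 2)^-1); congr in_plane.
rewrite (linearP J) (linearZ_LR J) J2.
by apply: b_inj => z; rewrite !bE; field; apply: lt0r_neq0.
Qed.

(** Together with [J y], which pairs to [0] with [Z] and to [1] with [J Z], the
vector [y] gives coordinates on the plane.  It is found in [<e, J e>] by
solving a 2 x 2 system of determinant [1 + b(J Z, e)^2]. *)
Lemma dual_pair : exists2 y, b Z y = 1 & b w y = 0.
Proof.
have c0 : 1 + b w e ^+ 2 != 0.
  by apply: lt0r_neq0; apply: ltr_wpDr; rewrite ?sqr_ge0.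
exists ((1 + b w e ^+ 2)^-1 *: (e - b w e *: J e)); rewrite !bE.
  by rewrite bJ bZe; field.
by rewrite bJJ bZe; field.
Qed.

Lemma br_Z y : br Z y = 0.
Proof. by rewrite /dext_bracket bZZ EZ b0l !scale0r scaler0 subr0 addr0. Qed.

(** [Z] is central, so integrability at [(Z, y)] says that [ad (J Z)] commutes
with [J]; evaluating at the dual vector [y] expresses [E (J Z)] in the
plane. *)
Lemma E_JZ : exists a c : R, E w = a *: Z + c *: w.
Proof.
have [y bZy bwy] := dual_pair.
exists (b (E w) y), (b (E w) (J y)).
have := J_integrable Z y; rewrite !br_Z sub0r addr0 /dext_bracket bxJx bZy bJ bwy.
rewrite oppr0 !scale0r scale1r subr0 add0r linearN (linearZ_LR J) /= => h.
apply: b_inj => z; have := congr1 (b^~ z) h; rewrite !bE => ?; lra.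
Qed.

Lemma perp_plane_E x : perp_plane x -> perp_plane (E x).
Proof.
have [a [c Ew]] := E_JZ; move=> [h1 h2].
have sk y : b y (E x) = - b (E y) x by rewrite b_skew opprK.
by split; rewrite sk ?EZ ?Ew !bE ?h1 ?h2; ring.
Qed.

Lemma in_plane_E x : in_plane x -> in_plane (E x).
Proof.
have [a [c Ew]] := E_JZ; move=> [k [l ->]]; exists (l * a), (l * c).
rewrite (linearP E) (linearZ_LR E) EZ Ew.
by apply: b_inj => z; rewrite !bE; ring.
Qed.

(** Let [c = E J x - J E x] and [p = b(Z, J e)].  Modulo the plane, integrability
at [(e, x)] reads [c + p J c = 0], and [1 + p J] is invertible. *)
Lemma in_plane_commutator x : perp_plane x -> in_plane (E (J x) - J (E x)).
Proof.
move=> px; have [bZx _] := px; have [bZJx _] := perp_plane_J _ px.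
apply: (in_plane_resolvent 1 (b Z (J e))); first by have := sqr_ge0 (b Z (J e)); lra.
exists (- (b (E (J e)) x + b (E e) (J x))), (b (E e) x - b (E (J e)) (J x)).
have := J_integrable e x; rewrite /dext_bracket bZx bZJx bZe !scale0r !subr0 !scale1r.
rewrite !(linearB J, linearD J, linearZ_LR J) /= J2 => h.
apply: b_inj => z; have := congr1 (b^~ z) h; rewrite !bE => ?; lra.
Qed.

Lemma perp_planeB c x y : perp_plane x -> perp_plane y -> perp_plane (x - c *: y).
Proof. by move=> [h1 h2] [h3 h4]; split; rewrite !bE ?h1 ?h2 ?h3 ?h4; ring. Qed.

Lemma shifts_perp_plane cs x : perp_plane x -> perp_plane (shifts E cs x).
Proof.
move=> px; elim: cs => //= c cs IH; apply: perp_planeB => //; exact: perp_plane_E.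
Qed.

Lemma shifts_commutator cs x :
  perp_plane x -> in_plane (shifts E cs (J x) - J (shifts E cs x)).
Proof.
move=> px; elim: cs => [|c cs IH] /=; first by rewrite subrr; apply: in_plane0.
have := in_plane_commutator _ (shifts_perp_plane cs _ px).
move: (shifts E cs x) (shifts E cs (J x)) IH => y z Pzy Py.
have := in_planeB _ _ (in_planeD _ _ Py (in_plane_E _ Pzy)) (in_planeZ c _ Pzy).
congr in_plane.
rewrite !(linearB E, linearB J, linearZ_LR J) /=.
by apply: b_inj => t; rewrite !bE; ring.
Qed.

(** A product of shifts of [E] commutes with [J] on [P^perp / P].  If its image
there is contained in the real line of the class of [v = T x], then
[J v = s v] for a real [s], which forces [v] to vanish in the quotient. *)
Lemma no_rank_one cs x : perp_plane x ->
  (forall y, perp_plane y -> exists s, in_plane (shifts E cs y - s *: shifts E cs x)) ->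
  in_plane (shifts E cs x).
Proof.
move=> px line; have [s Ps] := line _ (perp_plane_J _ px).
have := in_planeB _ _ Ps (shifts_commutator cs _ px).
move: (shifts E cs x) (shifts E cs (J x)) => y z h.
apply: (in_plane_resolvent (- s) 1); first by have := sqr_ge0 s; rewrite sqrrN; lra.
move: h; congr in_plane.
by apply: b_inj => t; rewrite !bE; ring.
Qed.

Lemma plane_coord_inj a c a' c' :
  a *: Z + c *: w = a' *: Z + c' *: w -> a = a' /\ c = c'.
Proof.
have [y bZy bwy] := dual_pair => h; split.
  by have := congr1 (b^~ y) h; rewrite /= !bE bZy bwy; lra.
by have := congr1 (b^~ (J y)) h; rewrite /= !bE bJJ bZy bJ bwy; lra.
Qed.

(** On the plane [E] is triangular with [E Z = 0], so a nonzero eigenvalue there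
must be the diagonal coefficient of [J Z]. *)
Lemma eigenvector_in_plane lam x : lam != 0 -> x != 0 -> in_plane x -> E x = lam *: x ->
  exists a, E w = a *: Z + lam *: w.
Proof.
move=> lam0 x0 [k [l xE]]; have [a [c Ew]] := E_JZ; rewrite xE Ew.
rewrite (linearP E) (linearZ_LR E) EZ Ew => h.
have {h} h : (l * a) *: Z + (l * c) *: w = (lam * k) *: Z + (lam * l) *: w.
  by apply: b_inj => z; have := congr1 (b^~ z) h; rewrite /= !bE => ?; lra.
have [h1 h2] := plane_coord_inj _ _ _ _ h.
have l0 : l != 0.
  apply: contra_neq x0 => l0; move: h1; rewrite xE l0 mul0r => /esym/eqP.
  by rewrite mulf_eq0 (negPf lam0) => /eqP ->; rewrite !scale0r addr0.
exists a; congr (_ + _ *: _); apply: (mulfI l0); rewrite h2; ring.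
Qed.

(** Let [T] be the product of shifts, so that [T] composed with [E - lam] is
[phi] times [u].  If [phi] is nonzero on [P^perp], then this operator has rank
at most one on [P^perp / P], which puts [u] in the plane; then [T] itself has
rank at most one there, which puts [u'] in the plane too.  But [E] kills [Z],
so it has no Jordan block of size two with eigenvalue [lam <> 0] on [P].
If [phi] vanishes on [P^perp], then [phi] is pairing with a vector of [P],
which by skewness is an eigenvector for [- lam], and [T] maps [P^perp] to the
line of [u]; again [u] lies in [P], so that [lam = - lam]. *)
Theorem no_isolated_jordan_pair lam cs u u' (phi psi : V -> R) x0 :
  lam != 0 -> u != 0 -> E u = lam *: u -> E u' = lam *: u' + u ->
  (forall x, shifts E cs x = phi x *: u' + psi x *: u) -> phi x0 != 0 -> False.
Proof.
move=> lam0 u0 Eu Eu' TE phi0.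
have NT x : shifts E (lam :: cs) x = phi x *: u.
  rewrite /= TE (linearP E) (linearZ_LR E) Eu Eu'.
  by apply: b_inj => z; rewrite !bE; ring.
have u_inj k l : k *: u = l *: u -> k = l.
  by move/eqP; rewrite -subr_eq0 -scalerBl scaler_eq0 (negPf u0) orbF
    subr_eq0 => /eqP.
have phiP a x y : phi (a *: x + y) = a * phi x + phi y.
  apply: u_inj; rewrite -NT (linear_shifts E) !NT scalerDl scalerA //.
have phiE x : phi (E x) = lam * phi x.
  by apply: u_inj; rewrite -NT shifts_comm NT (linearZ_LR E) Eu !scalerA mulrC.
have inPu_lam : in_plane u -> exists a, E w = a *: Z + lam *: w.
  by move=> Pu; apply: (eigenvector_in_plane _ u).
have phi_perp x : perp_plane x -> phi x = 0.
  move=> px; apply/eqP/negPn/negP => phix0.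
  have Pu : in_plane u.
    have /(in_planeZ (phi x)^-1) : in_plane (shifts E (lam :: cs) x).
      apply: no_rank_one => // y _; exists (phi y / phi x).
      by rewrite !NT scalerA divfK // subrr; apply: in_plane0.
    by rewrite NT scalerA mulVf // scale1r.
  have Pu' : in_plane u'.
    have : in_plane (shifts E cs x).
      apply: no_rank_one => // y _; exists (phi y / phi x); rewrite !TE.
      have := in_planeZ (psi y - phi y / phi x * psi x) _ Pu; congr in_plane.
      by apply: b_inj => z; rewrite !bE; field.
    rewrite TE => h; have := in_planeB _ _ h (in_planeZ (psi x) _ Pu).
    by rewrite addrK => /(in_planeZ (phi x)^-1); rewrite scalerA mulVf // scale1r.
  have [a Ew] := inPu_lam Pu.
  have [k [l uE]] := Pu; have [k' [l' u'E]] := Pu'.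
  have h : (l * a) *: Z + (l * lam) *: w = (lam * k) *: Z + (lam * l) *: w.
    move: Eu; rewrite uE (linearP E) (linearZ_LR E) EZ Ew => h.
    by apply: b_inj => z; have := congr1 (b^~ z) h; rewrite /= !bE => ?; lra.
  have h' : (l' * a) *: Z + (l' * lam) *: w
            = (lam * k' + k) *: Z + (lam * l' + l) *: w.
    move: Eu'; rewrite uE u'E (linearP E) (linearZ_LR E) EZ Ew => h'.
    by apply: b_inj => z; have := congr1 (b^~ z) h'; rewrite /= !bE => ?; lra.
  have [h1 _] := plane_coord_inj _ _ _ _ h; have [_ h2] := plane_coord_inj _ _ _ _ h'.
  have l0 : l = 0 by lra.
  have : k = 0.
    by move: h1; rewrite l0 mul0r => /esym/eqP; rewrite mulf_eq0 (negPf lam0) => /eqP.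
  by move=> k0; move: u0; rewrite uE k0 l0 !scale0r addr0 eqxx.
have [y bZy bwy] := dual_pair.
(* Subtract from x its component dual to the plane: what is left is in P^perp. *)
have phi_P x : phi x = b (phi y *: Z + phi (J y) *: w) x.
  have /phi_perp : perp_plane (- b Z x *: y + (- b w x *: J y + x)).
    by split; rewrite !bE ?bJJ ?bZy ?bJ ?bwy; ring.
  rewrite !phiP !bE; lra.
have [a [c Ew]] := E_JZ.
have h : (phi (J y) * a) *: Z + (phi (J y) * c) *: w
         = (- lam * phi y) *: Z + (- lam * phi (J y)) *: w.
  apply: b_inj => z.
  have := phiE z; rewrite (phi_P z) (phi_P (E z)).
  have sk v : b v (E z) = - b (E v) z by rewrite b_skew opprK.
  rewrite sk (linearP E) (linearZ_LR E) EZ Ew !bE; lra.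
have [h1 h2] := plane_coord_inj _ _ _ _ h.
have l0 : phi (J y) != 0.
  apply: contra_neq phi0 => l0; move: h1; rewrite (phi_P x0) l0 mul0r => /esym/eqP.
  by rewrite mulf_eq0 oppr_eq0 (negPf lam0) => /eqP ->; rewrite !bE; ring.
have cE : c = - lam by apply: (mulfI l0); rewrite h2 mulrC.
(* E (J Z) has diagonal coefficient - lam, which makes (E - lam) (J y)
   orthogonal to the plane, while T maps it to a nonzero multiple of u. *)
pose x := E (J y) - lam *: J y.
have sk v z : b v (E z) = - b (E v) z by rewrite b_skew opprK.
have px : perp_plane x.
  by split; rewrite /x !bE ?sk ?EZ ?Ew !bE ?bJJ ?bZy ?bJ ?bwy ?cE; ring.
have Tx : shifts E cs x = phi (J y) *: u.
  by rewrite -NT /x /= -shifts_comm addrC -scaleNr (linear_shifts E) scaleNr addrC.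
have Pu : in_plane u.
  have /(in_planeZ (phi (J y))^-1) : in_plane (shifts E cs x).
    apply: no_rank_one => // z /phi_perp phiz.
    exists (psi z / phi (J y)); rewrite Tx TE phiz scale0r add0r scalerA divfK //.
    by rewrite subrr; apply: in_plane0.
  by rewrite Tx scalerA mulVf // scale1r.
have [a' Ew'] := inPu_lam Pu.
have := plane_coord_inj _ _ _ _ (etrans (esym Ew) Ew'); rewrite cE => -[_ h3].
by move/eqP: lam0; apply; lra.
Qed.

End DoubleExtension.

(** * Jordan blocks *)

Lemma jordan_mulmxE (F : nzRingType) r (t : F) (x : 'cV[F]_r.+1) (i : 'I_r.+1) :
  (jordan_block r.+1 t *m x) i 0 =
    t * x i 0 + (if (i < r)%N then x (inord i.+1) 0 else 0).
Proof.
rewrite mxE; under eq_bigr => j _ do rewrite mxE mulrDl.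
rewrite big_split /= (bigD1 i) //= eqxx big1 ?addr0 => [|j ji]; last first.
  by rewrite (_ : _ == _ = false) ?mul0r //; apply: contraNF ji => /eqP/val_inj ->.
congr (_ + _); case: ifP => ir.
  rewrite (bigD1 (inord i.+1)) //= inordK // eqxx mul1r big1 ?addr0 // => j ji.
  case: eqP => [e|]; rewrite ?mul0r //; case/eqP: ji; apply: val_inj.
  by rewrite /= inordK.
rewrite big1 // => j _; case: eqP => [e|]; rewrite ?mul0r //.
by have := ltn_ord j; rewrite e ltnS ir.
Qed.

Lemma tr_jordan_mulmxE (F : nzRingType) r (t : F) (x : 'cV[F]_r.+1) (i : 'I_r.+1) :
  ((jordan_block r.+1 t)^T *m x) i 0 =
    t * x i 0 + (if (0 < i)%N then x (inord i.-1) 0 else 0).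
Proof.
rewrite mxE; under eq_bigr => j _ do rewrite !mxE mulrDl.
rewrite big_split /= (bigD1 i) //= eqxx big1 ?addr0 => [|j ji]; last first.
  by rewrite (_ : _ == _ = false) ?mul0r //; apply: contraNF ji => /eqP/val_inj ->.
congr (_ + _); case: ifP => i0.
  have iE : (inord i.-1 : 'I_r.+1) = i.-1 :> nat by rewrite inordK // ltnW // prednK.
  rewrite (bigD1 (inord i.-1)) //= iE prednK // eqxx mul1r big1 ?addr0 // => j ji.
  case: eqP => [e|]; rewrite ?mul0r //; case/eqP: ji; apply: val_inj.
  by rewrite /= iE e.
rewrite big1 // => j _; case: eqP => [e|]; rewrite ?mul0r //.
by rewrite e in i0.
Qed.

Lemma shifts_mulmx_consE (F : fieldType) n (A : 'M[F]_n) c cs (x : 'cV[F]_n) i :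
  shifts (mulmx A) (c :: cs) x i 0 =
    (A *m shifts (mulmx A) cs x) i 0 - c * shifts (mulmx A) cs x i 0.
Proof. by rewrite /= !mxE. Qed.

(** Each factor [J_r(t) - t] shifts the coordinates up by one place, while the
factors with [c <> t] are triangular with diagonal [t - c].  With [k] factors
of the first kind the last [k] coordinates vanish and the one just above them
is a multiple of the last coordinate of [x]. *)
Lemma shifts_jordan (F : fieldType) r (t : F) cs (x : 'cV[F]_r.+1) (i : 'I_r.+1) :
  (r <= i + count_mem t cs)%N ->
  shifts (mulmx (jordan_block r.+1 t)) cs x i 0 =
    if (r == i + count_mem t cs)%N
    then (\prod_(c <- cs | c != t) (t - c)) * x ord_max 0 else 0.
Proof.
elim: cs i => [|c cs IH] i.
  rewrite /= addn0 big_nil mul1r => ri.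
  have -> : i = ord_max by apply: val_inj; apply/eqP; rewrite eqn_leq ri -ltnS ltn_ord.
  by rewrite eqxx.
rewrite shifts_mulmx_consE jordan_mulmxE big_cons /=.
have [ct|ct] /= := eqVneq c t.
  rewrite ct addrAC subrr add0r add1n addnS => ri.
  case: ifP => [ir|/negbT]; last first.
    rewrite -leqNgt => ri'; case: eqP => // e; lia.
  by rewrite IH inordK // addSn.
rewrite add0n addrAC -mulrBl => ri.
rewrite (IH i) //; set y := if (i < r)%N then _ else _.
have -> : y = 0.
  rewrite /y; case: ifP => // ir; rewrite IH inordK ?addSn //; last exact: leqW.
  by case: eqP => // e; move: ri; rewrite -ltnS -e ltnn.
by rewrite addr0; case: eqP => _; rewrite ?mulr0 // mulrA.
Qed.

Lemma shifts_tr_jordan (F : fieldType) r (t : F) cs (x : 'cV[F]_r.+1) (i : 'I_r.+1) :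
  (i < count_mem (- t) cs)%N ->
  shifts (mulmx (- (jordan_block r.+1 t)^T)) cs x i 0 = 0.
Proof.
elim: cs i => [|c cs IH] i //.
rewrite shifts_mulmx_consE mulNmx [X in X - _]mxE tr_jordan_mulmxE /=.
have [->|ct] /= := eqVneq c (- t).
  rewrite add1n ltnS opprD addrAC mulNr opprK addNr add0r => ri.
  case: ifP => [i0|_]; last by rewrite oppr0.
  have i1 : (i.-1 < r.+1)%N by rewrite (leq_ltn_trans (leq_pred _)).
  by rewrite IH ?oppr0 // inordK // (leq_trans _ ri) // prednK.
rewrite add0n => ri; rewrite (IH i) //.
case: ifP => [i0|_]; last by rewrite !mulr0 !(addr0, oppr0).
have i1 : (i.-1 < r.+1)%N by rewrite (leq_ltn_trans (leq_pred _)).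
rewrite (IH (inord _)) ?inordK ?(leq_ltn_trans (leq_pred _)) //.
by rewrite !mulr0 !(addr0, oppr0).
Qed.

Section DirectSum.

Variables (F : fieldType) (p q : nat) (A : 'M[F]_p) (B : 'M[F]_q).

Lemma dsum_mul_col (x : 'cV[F]_p) (y : 'cV[F]_q) :
  dsum_mx A B *m col_mx x y = col_mx (A *m x) (B *m y).
Proof. by rewrite mul_block_col !mul0mx addr0 add0r. Qed.

Lemma shifts_dsum_mx cs (x : 'cV[F]_p) (y : 'cV[F]_q) :
  shifts (mulmx (dsum_mx A B)) cs (col_mx x y) =
    col_mx (shifts (mulmx A) cs x) (shifts (mulmx B) cs y).
Proof.
elim: cs => //= c cs ->.
by rewrite dsum_mul_col scale_col_mx opp_col_mx add_col_mx.
Qed.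

End DirectSum.

Definition annihilates {F : fieldType} {n} (cs : seq F) (A : 'M[F]_n) : Prop :=
  forall x : 'cV[F]_n, shifts (mulmx A) cs x = 0.

(** The product of the [A - c] has image in the span of a Jordan chain [u], [u']
of length two.  As [(A - lam) u' = u], the condition [phi x != 0] says that
applying one more factor [A - lam] does not give zero. *)
Definition isolates_pair {F : fieldType} {n} (cs : seq F) (A : 'M[F]_n) (lam : F) :
    Prop :=
  exists (u u' : 'cV[F]_n) (phi psi : 'cV[F]_n -> F),
    [/\ u != 0, A *m u = lam *: u, A *m u' = lam *: u' + u,
        forall x, shifts (mulmx A) cs x = phi x *: u' + psi x *: u
      & exists x, phi x != 0].

Lemma annihilates_dsum (F : fieldType) p q cs (A : 'M[F]_p) (B : 'M[F]_q) :
  annihilates cs A -> annihilates cs B -> annihilates cs (dsum_mx A B).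
Proof.
by move=> cA cB x; rewrite -[x]vsubmxK shifts_dsum_mx cA cB col_mx0.
Qed.

Lemma annihilates0 (F : fieldType) n (cs : seq F) :
  0 \in cs -> annihilates cs (0 : 'M[F]_n).
Proof.
move=> cs0 x; elim: cs cs0 => // c cs IH; rewrite inE /= mul0mx sub0r.
by case/orP=> [/eqP <-|/IH ->]; rewrite ?scale0r ?scaler0 oppr0.
Qed.

Lemma annihilates_jordan (F : fieldType) r (t : F) cs :
  (r <= count_mem t cs)%N -> annihilates cs (jordan_block r t).
Proof.
case: r => [|r] rcs x; first by apply/matrixP => -[].
apply/colP => i; rewrite shifts_jordan ?mxE; last first.
  by rewrite (leq_trans (ltnW rcs)) // leq_addl.
by case: eqP => // e; lia.
Qed.

Lemma annihilates_tr_jordan (F : fieldType) r (t : F) cs :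
  (r <= count_mem (- t) cs)%N -> annihilates cs (- (jordan_block r t)^T).
Proof.
case: r => [|r] rcs x; first by apply/matrixP => -[].
apply/colP => i; rewrite shifts_tr_jordan ?mxE //.
by rewrite (leq_trans _ rcs).
Qed.

Lemma opp_tr_dsum (F : fieldType) p q (A : 'M[F]_p) (B : 'M[F]_q) :
  - (dsum_mx A B)^T = dsum_mx (- A^T) (- B^T).
Proof. by rewrite /dsum_mx tr_block_mx opp_block_mx !trmx0 !oppr0. Qed.

Lemma isolates_pair_dsuml (F : fieldType) p q cs (A : 'M[F]_p) (B : 'M[F]_q) lam :
  isolates_pair cs A lam -> annihilates cs B -> isolates_pair cs (dsum_mx A B) lam.
Proof.
move=> [u [u' [phi [psi [u0 Au Au' TA [x phix]]]]]] cB.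
exists (col_mx u 0), (col_mx u' 0), (phi \o usubmx), (psi \o usubmx).
split; rewrite ?dsum_mul_col ?mulmx0 ?Au ?Au'.
- by rewrite col_mx_eq0 negb_and u0.
- by rewrite scale_col_mx scaler0.
- by rewrite scale_col_mx scaler0 add_col_mx addr0.
- move=> y; rewrite -[y in LHS]vsubmxK shifts_dsum_mx TA cB.
  by rewrite !scale_col_mx !scaler0 add_col_mx addr0.
by exists (col_mx x 0); rewrite /= col_mxKu.
Qed.

Lemma isolates_pair_dsumr (F : fieldType) p q cs (A : 'M[F]_p) (B : 'M[F]_q) lam :
  annihilates cs A -> isolates_pair cs B lam -> isolates_pair cs (dsum_mx A B) lam.
Proof.
move=> cA [u [u' [phi [psi [u0 Bu Bu' TB [x phix]]]]]].
exists (col_mx 0 u), (col_mx 0 u'), (phi \o dsubmx), (psi \o dsubmx).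
split; rewrite ?dsum_mul_col ?mulmx0 ?Bu ?Bu'.
- by rewrite col_mx_eq0 negb_and u0 orbT.
- by rewrite scale_col_mx scaler0.
- by rewrite scale_col_mx scaler0 add_col_mx addr0.
- move=> y; rewrite -[y in LHS]vsubmxK shifts_dsum_mx TB cA.
  by rewrite !scale_col_mx !scaler0 add_col_mx addr0.
by exists (col_mx 0 x); rewrite /= col_mxKd.
Qed.

(** With multiplicity [r] for [t], a block of size [r + 2] keeps only its first
two coordinates, which span the chain [u = e_0], [u' = e_1]; on the last basis
vector the coefficient of [e_1] is the product of the [t - c] with
[c <> t]. *)
Lemma isolates_pair_jordan (F : fieldType) r (t : F) cs :
  count_mem t cs = r -> isolates_pair cs (jordan_block r.+2 t) t.
Proof.
move=> csr.
pose T (x : 'cV[F]_r.+2) : 'cV[F]_r.+2 := shifts (mulmx (jordan_block r.+2 t)) cs x.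
pose i1 : 'I_r.+2 := inord 1.
have i1E : i1 = 1%N :> nat by rewrite inordK.
exists (delta_mx ord0 0), (delta_mx i1 0), (fun x => T x i1 0), (fun x => T x ord0 0).
split.
- apply/eqP => /matrixP /(_ ord0 0); rewrite !mxE !eqxx => /eqP.
  by rewrite oner_eq0.
- apply/colP => i; rewrite jordan_mulmxE !mxE andbT eqxx andbT.
  case: ifP => [ir|_]; rewrite ?addr0 //.
  by rewrite (_ : inord i.+1 == ord0 = false) ?addr0 // -val_eqE /= inordK.
- apply/colP => i; rewrite jordan_mulmxE !mxE !eqxx !andbT; congr (_ + _).
  case: ifP => [ir|]; first by rewrite -!val_eqE /= !inordK.
  by case: eqP => // ->.
- move=> x; apply/colP => i; rewrite !mxE !eqxx !andbT.
  have [i0|i0] := eqVneq i ord0.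
    rewrite i0 (_ : ord0 == i1 = false) ?mulr0 ?mulr1 ?add0r //.
    by rewrite -val_eqE /= i1E.
  have [->|ni1] := eqVneq i i1; first by rewrite mulr1 mulr0 addr0.
  rewrite !mulr0 addr0.
  have i2 : (2 <= i)%N.
    by move: i0 ni1; rewrite -!val_eqE /= i1E; case: (nat_of_ord i) => [|[|]].
  rewrite shifts_jordan csr; last by lia.
  by case: eqP => // e; lia.
exists (delta_mx ord_max 0); rewrite /T shifts_jordan csr i1E add1n // eqxx mxE !eqxx.
rewrite mulr1 prodf_seq_neq0; apply/allP => c _; apply/implyP => ct.
by rewrite subr_eq0 eq_sym.
Qed.

(** * The Courant bracket of a semidirect product *)

Section CourantAlgebra.

Variables (F : fieldType) (m : nat) (A : 'M[F]_m).

(** Twice the pairing, so that the Courant bracket has coefficients without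
denominators. *)
Definition gram {n} (x y : 'cV[F]_(n + n)) : F :=
  ev (dsubmx x) (usubmx y) + ev (dsubmx y) (usubmx x).

(** The bracket with [e_0] on [g (+) g^*]; the two 1 x 1 zero blocks are the lines
of [e_0] and of its dual covector. *)
Definition ad_e0 : 'M[F]_((1 + m) + (1 + m)) :=
  dsum_mx (dsum_mx (0 : 'M_1) A) (dsum_mx (0 : 'M_1) (- A^T)).

Definition vec_e0 : 'cV[F]_((1 + m) + (1 + m)) := col_mx (col_mx 1%:M 0) 0.
Definition covec_e0 : 'cV[F]_((1 + m) + (1 + m)) := col_mx 0 (col_mx 1%:M 0).

Lemma ev_col p q (x1 y1 : 'cV[F]_p) (x2 y2 : 'cV[F]_q) :
  ev (col_mx x1 x2) (col_mx y1 y2) = ev x1 y1 + ev x2 y2.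
Proof. by rewrite /ev tr_col_mx mul_row_col mxE. Qed.

Lemma evC n (x y : 'cV[F]_n) : ev x y = ev y x.
Proof. by rewrite /ev -[in LHS](trmxK y) -trmx_mul mxE. Qed.

Lemma ev_scalar n (y : 'cV[F]_n) : scalar (fun x => ev x y).
Proof. by move=> a x z; rewrite /ev linearP /= mulmxDl -scalemxAl !mxE. Qed.

Lemma ev0 n (y : 'cV[F]_n) : ev 0 y = 0.
Proof. by rewrite /ev trmx0 mul0mx mxE. Qed.

Lemma evZ n a (x y : 'cV[F]_n) : ev (a *: x) y = a * ev x y.
Proof. by rewrite -[a *: x]addr0 ev_scalar ev0 addr0. Qed.

Lemma ev_r0 n (y : 'cV[F]_n) : ev y 0 = 0.
Proof. by rewrite evC ev0. Qed.

Lemma gramC n (x y : 'cV[F]_(n + n)) : gram x y = gram y x.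
Proof. by rewrite /gram addrC. Qed.

Lemma gram_scalar n (y : 'cV[F]_(n + n)) : scalar (fun x => gram x y).
Proof.
move=> a x z; rewrite /gram !linearP /= ev_scalar ![ev (dsubmx y) _]evC ev_scalar.
by ring.
Qed.

Lemma ev_delta n (x : 'cV[F]_n) i : ev x (delta_mx i 0) = x i 0.
Proof. by rewrite /ev -colE !mxE. Qed.

Lemma gram_nondeg n (x : 'cV[F]_(n + n)) : (forall y, gram x y = 0) -> x = 0.
Proof.
move=> x0; rewrite -[x]vsubmxK; apply/eqP; rewrite col_mx_eq0.
apply/andP; split; apply/eqP/colP => j.
  have := x0 (col_mx 0 (delta_mx j 0)).
  by rewrite /gram col_mxKu col_mxKd ev_r0 add0r evC ev_delta => ->; rewrite mxE.
have := x0 (col_mx (delta_mx j 0) 0).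
by rewrite /gram col_mxKu col_mxKd ev0 addr0 ev_delta => ->; rewrite mxE.
Qed.

Lemma gram_ad_e0 x y : gram (ad_e0 *m x) y = - gram x (ad_e0 *m y).
Proof.
rewrite -[x]vsubmxK -[y]vsubmxK !dsum_mul_col /gram !col_mxKu !col_mxKd.
move: (usubmx x) (dsubmx x) (usubmx y) (dsubmx y) => {x y} x1 x2 y1 y2.
rewrite -[x1]vsubmxK -[x2]vsubmxK -[y1]vsubmxK -[y2]vsubmxK !dsum_mul_col !ev_col.
rewrite !mul0mx !ev0 !ev_r0 !add0r /ev !mulNmx !linearN /= !mulNmx !trmx_mul !trmxK.
by rewrite !mulmxA ![fun_of_matrix (- _) 0 0]mxE; ring.
Qed.

Lemma gram_covec x : gram covec_e0 x = usubmx (usubmx x) 0 0.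
Proof.
rewrite /gram col_mxKu col_mxKd ev_r0 addr0 -[usubmx x in LHS]vsubmxK ev_col.
by rewrite ev0 addr0 /ev trmx1 mul1mx.
Qed.

Lemma coad_semidirect (x xi : 'cV[F]_(1 + m)) :
  coad (semidirect_bracket A) x xi =
  col_mx (ev (dsubmx xi) (A *m dsubmx x))%:M
         (- (usubmx x 0 0 *: (A^T *m dsubmx xi))).
Proof.
apply/colP => j; rewrite mxE -[xi]vsubmxK /semidirect_bracket col_mxKd.
move: (dsubmx xi) (usubmx xi) => {xi} c2 c1.
rewrite ev_col ev_r0 add0r; case: (split_ordP j) => k ->.
  rewrite col_mxEu delta_mx_ushift col_mxKu col_mxKd mulmx0 scaler0 sub0r.
  rewrite !ord1 [delta_mx _ _ _ _]mxE eqxx scale1r -scaleN1r evC evZ mulN1r opprK.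
  by rewrite evC mxE eqxx.
rewrite col_mxEd delta_mx_dshift col_mxKu col_mxKd.
rewrite [fun_of_matrix 0 _ _]mxE scale0r subr0 evC evZ evC.
rewrite [in RHS]mxE [in RHS]mxE; congr (- (_ * _)).
rewrite /ev mulmxA -colE !mxE; apply: eq_bigr => l _.
by rewrite !mxE mulrC.
Qed.

Lemma ad_e0_mul (x : 'cV[F]_((1 + m) + (1 + m))) : ad_e0 *m x =
  col_mx (col_mx 0 (A *m dsubmx (usubmx x))) (col_mx 0 (- (A^T *m dsubmx (dsubmx x)))).
Proof.
rewrite -[x in LHS]vsubmxK -[usubmx x in LHS]vsubmxK -[dsubmx x in LHS]vsubmxK.
by rewrite !dsum_mul_col !mul0mx mulNmx.
Qed.

Lemma gram_ad_e0_mul (u v : 'cV[F]_((1 + m) + (1 + m))) : gram (ad_e0 *m u) v =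
  ev (dsubmx (dsubmx v)) (A *m dsubmx (usubmx u))
  - ev (dsubmx (dsubmx u)) (A *m dsubmx (usubmx v)).
Proof.
rewrite ad_e0_mul /gram col_mxKu col_mxKd -[usubmx v in LHS]vsubmxK.
rewrite -[dsubmx v in LHS]vsubmxK !ev_col ev0 ev_r0 !add0r addrC -scaleN1r evZ mulN1r.
by congr (_ - _); rewrite /ev trmx_mul trmxK mulmxA.
Qed.

(** The coadjoint part of the bracket has an [h^*]-component, which completes
[A] to [ad_e0], and a component along the covector dual to [e_0], which is the
cocycle [gram (ad_e0 *m u) v]. *)
Lemma courant_semidirect u v :
  courant (semidirect_bracket A) u v = dext_bracket gram (mulmx ad_e0) covec_e0 u v.
Proof.
rewrite /courant !coad_semidirect /dext_bracket !gram_covec gram_ad_e0_mul.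
rewrite !ad_e0_mul /semidirect_bracket !(scale_col_mx, opp_col_mx, add_col_mx).
rewrite !(scaler0, oppr0, addr0, add0r) scalerN opprK.
congr (col_mx _ (col_mx _ _)); last by rewrite scalerN opprK.
by rewrite scalemx1 raddfB.
Qed.

End CourantAlgebra.

Section RealForm.

Variables (R : realType).
Local Notation C := R[i].

Lemma toC_Re_Im m (X : 'cV[C]_m) : X = toC (Remx X) + 'i%C *: toC (Immx X).
Proof.
apply/colP => k; rewrite !mxE; apply/eqP; rewrite eq_complex /=; apply/andP.
by split; apply/eqP; ring.
Qed.

Lemma toC_inj m (x x' y y' : 'cV[R]_m) :
  toC x + 'i%C *: toC x' = toC y + 'i%C *: toC y' -> x = y /\ x' = y'.
Proof.
move=> h; split; apply/colP => k; have := congr1 (fun M : 'cV[C]_m => M k 0) h;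
  rewrite !mxE => /eqP; rewrite eq_complex /= => /andP[/eqP h1 /eqP h2]; lra.
Qed.

Lemma toC_mul_Re_Im m n (M : 'M[R]_(m, n)) (X : 'cV[C]_n) :
  toC M *m X = toC (M *m Remx X) + 'i%C *: toC (M *m Immx X).
Proof. by rewrite [in LHS](toC_Re_Im _ X) mulmxDr -scalemxAr /toC !map_mxM. Qed.

(** Complexifying the real bracket gives the semidirect product of the complex
matrix, so the formula for the Courant bracket applies over [C] as well. *)
Lemma complexify_semidirect m (A : 'M[R]_m) (X Y : 'cV[C]_(1 + m)) :
  complexify (semidirect_bracket A) X Y = semidirect_bracket (toC A) X Y.
Proof.
rewrite /complexify /semidirect_bracket !toC_mul_Re_Im.
have sub (Z : 'cV[C]_(1 + m)) : (dsubmx (Remx Z) = Remx (dsubmx Z)) *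
    (dsubmx (Immx Z) = Immx (dsubmx Z)) * (usubmx (Remx Z) = Remx (usubmx Z)) *
    (usubmx (Immx Z) = Immx (usubmx Z)).
  by rewrite /Remx /Immx !map_usubmx !map_dsubmx.
rewrite !sub !(opp_col_mx, add_col_mx) /toC !map_col_mx !scale_col_mx !add_col_mx.
congr col_mx; first by apply/colP => k; rewrite !mxE; apply/eqP; rewrite eq_complex /=;
  apply/andP; split; apply/eqP; ring.
move: (A *m _) (A *m _) (A *m _) (A *m _) => a1 a2 a3 a4.
move: (usubmx X) (usubmx Y) => x y.
apply/colP => k; rewrite !mxE; case: (x 0 0) (y 0 0) => [x1 x2] [y1 y2].
by apply/eqP; rewrite eq_complex /=; apply/andP; split; apply/eqP; ring.
Qed.

Lemma eq_courant (F : fieldType) n (br1 br2 : 'cV[F]_n -> 'cV[F]_n -> 'cV[F]_n) :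
  br1 =2 br2 -> courant br1 =2 courant br2.
Proof.
move=> eq_br; have eq_coad : coad br1 =2 coad br2.
  by move=> x xi; apply/colP => j; rewrite !mxE eq_br.
by move=> u v; rewrite /courant eq_br !eq_coad.
Qed.

Lemma dext_bracket_expand (F : comPzRingType) n (b : 'cV[F]_n -> 'cV[F]_n -> F)
    (E : {linear 'cV[F]_n -> 'cV[F]_n}) (Z : 'cV[F]_n) (k : F) (x x' y y' : 'cV[F]_n) :
  (forall z, scalar (fun x => b x z)) -> (forall z, scalar (b z)) ->
  dext_bracket b E Z (x + k *: x') (y + k *: y') =
    dext_bracket b E Z x y + k ^+ 2 *: dext_bracket b E Z x' y'
    + k *: (dext_bracket b E Z x y' + dext_bracket b E Z x' y).
Proof.
move=> bl br; have bl2 z t s : b (t + k *: s) z = b t z + k * b s z.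
  by rewrite addrC bl addrC.
have br2 z t s : b z (t + k *: s) = b z t + k * b z s by rewrite addrC br addrC.
have E2 t s : E (t + k *: s) = E t + k *: E s by rewrite addrC (linearP E) addrC.
rewrite /dext_bracket !E2 !br2 !bl2.
move: (E x) (E x') (E y) (E y') (b _ _) (b _ _) (b _ _) (b _ _) (b _ _) (b _ _)
  (b _ _) (b _ _) => *.
by apply/colP => i; rewrite !mxE; ring.
Qed.

End RealForm.

(** * From the eigenspace to the real structure *)

Section Integrability.
Variables (R : realType) (m : nat) (A : 'M[R]_m) (J : 'M[R]_((1 + m) + (1 + m))).
Local Notation C := R[i].
Local Notation br := (dext_bracket (@gram R _) (mulmx (ad_e0 _ _ A)) (covec_e0 _ m)).

Lemma gram_toC n (x y : 'cV[R]_(n + n)) : gram _ (toC x) (toC y) = (gram _ x y)%:C%C.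
Proof.
by rewrite /gram /ev /toC -!map_usubmx -!map_dsubmx !map_trmx -!map_mxM !mxE rmorphD.
Qed.

Lemma ad_e0_toC : ad_e0 _ _ (toC A) = toC (ad_e0 _ _ A).
Proof.
by rewrite /ad_e0 /dsum_mx /toC !map_block_mx !map_mx0 map_mxN map_trmx.
Qed.

Lemma covec_e0_toC : covec_e0 C m = toC (covec_e0 R m).
Proof. by rewrite /covec_e0 /toC !map_col_mx !map_mx0 map_mx1. Qed.

Lemma dext_bracket_toC x y :
  dext_bracket (@gram C _) (mulmx (ad_e0 _ _ (toC A))) (covec_e0 C m) (toC x) (toC y) =
    toC (br x y).
Proof.
rewrite /dext_bracket ad_e0_toC covec_e0_toC {2 4 6 8}/toC -!map_mxM !gram_toC.
by rewrite /toC map_mxD map_mxB !map_mxZ.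
Qed.

Hypothesis J2 : J *m J = - 1%:M.
Hypothesis closedL : forall u v, eigenL J u -> eigenL J v ->
  eigenL J (courant (complexify (semidirect_bracket A)) u v).

(** These vectors [x - i J x] are what is needed of the eigenspace [L]: they carry
the closedness of [L] back to real vectors. *)
Lemma eigenL_real x : eigenL J (toC x + - 'i%C *: toC (J *m x)).
Proof.
rewrite /eigenL mulmxDr -scalemxAr /toC -!map_mxM mulmxA J2 mulNmx mul1mx.
rewrite map_mxN scalerDr scalerA mulrN -expr2 sqr_i opprK scale1r.
by rewrite scalerN scaleNr opprK addrC.
Qed.

(** By bilinearity the bracket of [x - i J x] and [y - i J y] is [p - i q] with
[p] the argument of [J] on the left and [q] the right-hand side; it lies in
[L] exactly when [J p = q]. *)
Lemma integrable_real x y :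
  J *m (br x y - br (J *m x) (J *m y)) = br (J *m x) y + br x (J *m y).
Proof.
have := closedL _ _ (eigenL_real x) (eigenL_real y).
rewrite (eq_courant _ _ _ _ (complexify_semidirect _ _ A)).
rewrite courant_semidirect dext_bracket_expand; first last.
- by move=> z a s t; rewrite ![gram _ z _]gramC gram_scalar.
- by move=> z; apply: gram_scalar.
rewrite !dext_bracket_toC sqrrN sqr_i scaleN1r.
set a := br x y; set b := br (J *m x) (J *m y); set c := br _ _; set d := br _ _.
rewrite /eigenL mulmxDr -scalemxAr /toC -map_mxB -map_mxD -!map_mxM.
rewrite scalerDr scalerA mulrN -expr2 sqr_i opprK scale1r [in RHS]addrC.
rewrite scaleNr -scalerN -map_mxN => /toC_inj[-> _].
by rewrite addrC.
Qed.

End Integrability.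

(** The scalar [0] in [cs] kills the lines of [e_0] and of its dual covector, and
the last hypothesis kills [h^*], so a chain isolated in [A] is isolated in
[ad_e0]. *)
(** * The obstruction and its instances *)

Theorem no_gen_complex (R : realType) m (A : 'M[R]_m) lam cs :
  lam != 0 -> 0 \in cs -> isolates_pair cs A lam -> annihilates cs (- A^T) ->
  ~ exists J, gen_complex (semidirect_bracket A) J.
Proof.
move=> lam0 cs0 csA csN [J [J2 Jorth closedL]].
have : isolates_pair cs (ad_e0 _ _ A) lam.
  apply: isolates_pair_dsuml.
    by apply: isolates_pair_dsumr => //; apply: annihilates0.
  by apply: annihilates_dsum => //; apply: annihilates0.
case=> [u [u' [phi [psi [u0 Eu Eu' TE [x phix]]]]]].
apply: (@no_isolated_jordan_pair R _ (@gram R _) (mulmx (ad_e0 _ _ A)) (mulmx J)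
  (covec_e0 R m) (vec_e0 R m) _ _ _ _ _ _ _ _ _ _ lam cs u u' phi psi x) => //.
- by move=> y; apply: gram_scalar.
- by apply: gramC.
- by apply: gram_nondeg.
- by apply: gram_ad_e0.
- by rewrite /= ad_e0_mul col_mxKu !col_mxKd linear0 !mulmx0 oppr0 !col_mx0.
- by rewrite gram_covec /covec_e0 col_mxKu linear0 mxE.
- by rewrite gram_covec /vec_e0 !col_mxKu mxE.
- by move=> y; rewrite /= mulmxA J2 mulNmx mul1mx.
- move=> y z; apply: (mulfI _ (Jorth y z)).
  by rewrite invr_eq0 pnatr_eq0.
- exact: integrable_real.
Qed.

Lemma no_gen_complex_J5 (R : realType) (lam : R) : lam != 0 ->
  ~ exists J, gen_complex (semidirect_bracket (jordan_block 5 lam)) J.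
Proof.
move=> lam0; have Nlam : (- lam == lam) = false by apply/eqP; move/eqP: lam0; lra.
apply: (@no_gen_complex _ _ _ lam (nseq 3 lam ++ nseq 5 (- lam) ++ [:: 0])) => //.
- by rewrite !mem_cat mem_head !orbT.
- apply: isolates_pair_jordan.
  by rewrite /= eqxx Nlam eq_sym (negPf lam0).
- apply: annihilates_tr_jordan.
  by rewrite !count_cat !count_nseq /= eqxx; lia.
Qed.

(** If [mu] is [lam] or [- lam], the scalars that reduce the large block and kill
its dual already kill [mu] and [- mu]; adding them would change the
multiplicity of [lam]. *)
Lemma no_gen_complex_J4 (R : realType) (lam mu : R) : lam != 0 ->
  ~ exists J, gen_complex
      (semidirect_bracket (dsum_mx (jordan_block 4 lam) (jordan_block 1 mu))) J.
Proof.
move=> lam0; have Nlam : (- lam == lam) = false by apply/eqP; move/eqP: lam0; lra.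
pose cs := nseq 2 lam ++ nseq 4 (- lam) ++
  0 :: (if (mu == lam) || (mu == - lam) then [::] else [:: mu; - mu]).
have cs_lam : count_mem lam cs = 2.
  rewrite /cs /= eqxx Nlam eq_sym (negPf lam0).
  by case: ifP => //= /norP[/negPf -> h]; rewrite eqr_oppLR (negPf h).
have cs_Nlam : (4 <= count_mem (- lam) cs)%N.
  by rewrite !count_cat !count_nseq /= eqxx; lia.
have [cs_mu cs_Nmu] : (0 < count_mem mu cs)%N /\ (0 < count_mem (- mu) cs)%N.
  rewrite -!has_count !has_pred1 /cs !mem_cat !inE /=.
  case: eqP => [->|_]; first by rewrite !eqxx !orbT.
  case: eqP => [->|_]; first by rewrite opprK !eqxx !orbT.
  by rewrite !inE !eqxx !orbT.
apply: (@no_gen_complex _ _ _ lam cs) => //.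
- by rewrite !mem_cat mem_head !orbT.
- apply: isolates_pair_dsuml; first exact: isolates_pair_jordan.
  exact: annihilates_jordan.
- rewrite opp_tr_dsum.
  by apply: annihilates_dsum; apply: annihilates_tr_jordan.
Qed.

(** The isolated chain is in the block of [lam] if [lam <> 0], and otherwise it is
the whole block of [mu], for which [mu] must have multiplicity [0]. *)
Lemma no_gen_complex_J3_J2 (R : realType) (lam mu : R) : lam != mu -> lam != - mu ->
  ~ exists J, gen_complex
      (semidirect_bracket (dsum_mx (jordan_block 3 lam) (jordan_block 2 mu))) J.
Proof.
move=> lam_mu lam_Nmu; have [lam0|lam0] := eqVneq lam 0.
  pose cs := nseq 2 (- mu) ++ nseq 3 0.
  have mu0 : mu != 0 by rewrite -lam0 eq_sym.
  have Nmu : (- mu == mu) = false by apply/eqP; move/eqP: mu0; lra.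
  apply: (@no_gen_complex _ _ _ mu cs) => //.
  - by rewrite mem_cat orbC mem_head.
  - apply: isolates_pair_dsumr; first apply: annihilates_jordan.
      by rewrite lam0 count_cat !count_nseq /= eqxx; lia.
    by apply: isolates_pair_jordan; rewrite /= Nmu eq_sym (negPf mu0).
  - rewrite opp_tr_dsum lam0; apply: annihilates_dsum; apply: annihilates_tr_jordan;
      rewrite ?oppr0 count_cat !count_nseq /= eqxx; lia.
have Nlam : (- lam == lam) = false by apply/eqP; move/eqP: lam0; lra.
pose cs := lam :: nseq 3 (- lam) ++ nseq 2 mu ++ nseq 2 (- mu) ++ [:: 0].
apply: (@no_gen_complex _ _ _ lam cs) => //.
- by rewrite inE !mem_cat mem_head !orbT.
- apply: isolates_pair_dsuml.
    apply: isolates_pair_jordan.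
    by rewrite /= eqxx Nlam !(eq_sym _ lam) (negPf lam0) (negPf lam_mu) (negPf lam_Nmu).
  by apply: annihilates_jordan; rewrite /= ?eqxx; lia.
- rewrite opp_tr_dsum.
  by apply: annihilates_dsum; apply: annihilates_tr_jordan;
    rewrite /= ?eqxx; lia.
Qed.

Theorem proposition4p3 (R : realType) (A : 'M[R]_5)
  (hA : (exists lam : R, lam <> 0 /\ A = jordan_block 5 lam) \/
        (exists lam mu : R, lam <> 0 /\
           A = dsum_mx (jordan_block 4 lam) (jordan_block 1 mu)) \/
        (exists lam mu : R, lam <> mu /\ lam <> - mu /\
           A = dsum_mx (jordan_block 3 lam) (jordan_block 2 mu))) :
  (~ exists J : 'M[R]_((1 + 5) + (1 + 5)),
       gen_complex (semidirect_bracket A) J) /\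
  (~ exists J : 'M[R]_((1 + 5) + (1 + 5)),
       gen_calabi_yau (semidirect_bracket A) J).
Proof.
suff nogc : ~ exists J : 'M[R]_((1 + 5) + (1 + 5)),
    gen_complex (semidirect_bracket A) J.
  by split=> // -[J [gcJ _]]; apply: nogc; exists J.
case: hA => [[lam [/eqP lam0 ->]]|[[lam [mu [/eqP lam0 ->]]]|]].
- exact: no_gen_complex_J5.
- exact: no_gen_complex_J4.
- by case=> lam [mu [/eqP ? [/eqP ? ->]]]; apply: no_gen_complex_J3_J2.
Qed.
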